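(* An optimal solution of the vehicle-to-time-bucket assignment formulation (VA) can be transformed into an optimal solution of the corresponding tree-FRCVP problem.
   Context: **Problem (tree-FRCVP: tree-based fixed-route coordinated vehicle platooning).** A set $\mathcal{V}$ of vehicles is given. Each $v\in\mathcal{V}$ has an origin node $O_v$, a destination node $D_v$, an earliest allowable departure time $T^O_v$ from the origin, a latest allowed arrival time $T^D_v$ at the destination, and a given route $\mathcal{R}_v$ (a set of arcs forming a directed path from $O_v$ to $D_v$). Let $\mathcal{R}=\bigcup_{v\in\mathcal{V}}\mathcal{R}_v$ be the set of all arcs. Each arc $e=(i,j)$ has a travel time $T_e=T_{i,j}$ and a fuel cost $C_e=C_{i,j}$, the same for all vehicles. The fuel saving rates are constants, $\sigma^l$ for a lead vehicle and $\sigma^f$ for a trailing vehicle. Standing assumptions: the route graph $\mathcal{G}=\bigcup_{v\in\mathcal{V}}\mathcal{R}_v$ is a polytree, i.e., its undirected counterpart is a tree; once a vehicle has departed from its origin, it is not allowed to stop and wait at any intermediate node of its route; and the instance is irreducible, i.e., there is no partition $(\mathcal{V}_1,\mathcal{V}_2)$ of $\mathcal{V}$ such that $(\bigcup_{v\in\mathcal{V}_1}\mathcal{R}_v)\cap(\bigcup_{v\in\mathcal{V}_2}\mathcal{R}_v)=\emptyset$. A solution is a choice of departure time $t_{v,O_v}$ from the origin for each vehicle $v$; it is feasible if each $v$ departs no earlier than $T^O_v$ and arrives at $D_v$ no later than $T^D_v$. Multiple vehicles can form a platoon on an arc if they enter the starting node of the arc at the same time; at most $\lambda$ vehicles are allowed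 in a platoon, where $\lambda\ge 2$ is given. In a platoon of size at least two on arc $e$, the vehicle at the head is the lead vehicle, saving $\sigma^lC_e$, and each of the other vehicles is a trailing vehicle, saving $\sigma^fC_e$; a single vehicle saves nothing. The objective is to maximize the total fuel saving of all vehicles over all arcs. **Relative time windows.** An arbitrary node $r$ of $\mathcal{G}$ is fixed as the reference node. For a node $s$, consider the arcs of $\mathcal{G}$ whose undirected counterparts form the undirected path between $s$ and $r$; let $P^{\mathcal{G}}_{s\to r}$ be those pointing in the direction from $s$ to $r$ and $P^{\mathcal{G}}_{r\to s}$ those pointing in the direction from $r$ to $s$. The relative time difference of $s$ with respect to $r$ is $$\widetilde{T}_{s,r}=\sum_{(i,j)\in P^{\mathcal{G}}_{s\to r}}T_{i,j}-\sum_{(i,j)\in P^{\mathcal{G}}_{r\to s}}T_{i,j}.$$ Let $\underline{t}_{v,O_v}=T^O_v$ and $\overline{t}_{v,O_v}=T^D_v-\sum_{e\in\mathcal{R}_v}T_e$. The relative time window of $v$ is $\mathrm{RTW}_v=[\underline{t}_{v,O_v}+\widetilde{T}_{O_v,r},\ \overline{t}_{v,O_v}+\widetilde{T}_{O_v,r}]$. **Time buckets.** Form the list of all $2|\mathcal{V}|$ endpoints of the relative time windows, keeping duplicates, and sort it as $a_1\le a_2\le\dots\le a_{2|\mathcal{V}|}$. The sorted collection $\mathcal{S}$ of time buckets consists of those intervals $[a_k,a_{k+1}]$, $k=1,\dots,2|\mathcal{V}|-1$, in this order, that are contained in $\mathrm{RTW}_m$ for some $m\in\mathcal{V}$. A time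 bucket is feasible to vehicle $u$ if it is contained in $\mathrm{RTW}_u$; $\mathcal{S}_u$ is the set of time buckets feasible to $u$. For $e\in\mathcal{R}$ and $t\in\mathcal{S}$, $\mathcal{V}_{e,t}$ is the set of vehicles $u$ with $e\in\mathcal{R}_u$ and $t\in\mathcal{S}_u$. **Formulation (VA).** Its variables are: $x_{u,t}$, equal to 1 if vehicle $u$ is assigned to time bucket $t$ and 0 otherwise; $z_{e,t}$, the number of full-size platoons (of size $\lambda$) taking $e$ at $t$; $y_{e,t}$, equal to 1 if there is an unsaturated platoon (size at least one but less than $\lambda$) taking $e$ at $t$ and 0 otherwise; $y'_{e,t}$, equal to 1 if this unsaturated platoon has size at least 2 and 0 otherwise; $q_{e,t}$, the size of the unsaturated platoon; and $w_{e,t}$, the total number of trailing vehicles of platoons taking $e$ at $t$. The formulation (VA) is to maximize $$\sum_{e\in\mathcal{R}}\sum_{t\in\mathcal{S}}\left(\sigma^lC_ez_{e,t}+\sigma^lC_ey'_{e,t}+\sigma^fC_ew_{e,t}\right)$$ subject to $\sum_{t\in\mathcal{S}_u}x_{u,t}=1$ for all $u\in\mathcal{V}$ and, for all $e\in\mathcal{R}$, $t\in\mathcal{S}$: - $\lambda z_{e,t}-\sum_{u\in\mathcal{V}_{e,t}}x_{u,t}\le 0$; - $\lambda(z_{e,t}+1)-\sum_{u\in\mathcal{V}_{e,t}}x_{u,t}\ge 1$; - $w_{e,t}-\sum_{u\in\mathcal{V}_{e,t}}x_{u,t}+z_{e,t}+y_{e,t}=0$; - $q_{e,t}=\sum_{u\in\mathcal{V}_{e,t}}x_{u,t}-\lambda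 z_{e,t}$; - $y_{e,t}\le q_{e,t}$ and $\lambda y_{e,t}\ge q_{e,t}$; - $q_{e,t}\ge 2y'_{e,t}$ and $y'_{e,t}\le y_{e,t}$; - $x_{u,t},\,y_{e,t},\,y'_{e,t}\in\{0,1\}$ and $z_{e,t},\,q_{e,t},\,w_{e,t}\in\mathbb{Z}_{+}$ (nonnegative integers), for $u\in\mathcal{V}_{e,t}$. The corresponding tree-FRCVP problem is the instance from which (VA) is built.
   Formalization: Saving rates and fuel costs are taken nonnegative, and vehicles linked by a chain of common platoons may leave at most one unsaturated platoon on each arc; with arbitrary splitting of simultaneous vehicles into platoons the claim fails. *)

(* Defs.v *)
From HB Require Import structures.
From mathcomp Require Import all_boot all_order all_algebra.

Set Implicit Arguments.
Unset Strict Implicit.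
Unset Printing Implicit Defensive.

Import Order.TTheory GRing.Theory Num.Theory.
Local Open Scope ring_scope.

(* The arcs traversed by the walk that starts at x and then visits p. *)
Definition walk_arcs (N : eqType) (x : N) (p : seq N) : seq (N * N) :=
  zip (x :: p) p.

(* [stops v] lists the nodes visited by v after its origin, so that the route
   is a directed path from [orig v] to [dest v] by construction. *)
Record instance (R : realFieldType) (N V : finType) := Instance {
  orig : V -> N;
  dest : V -> N;
  stops : V -> seq N;
  earliest : V -> R;
  latest : V -> R;
  travel : N * N -> R;
  cost : N * N -> R;
  lead_rate : R;
  trail_rate : R;
  capacity : nat;
  stops_uniq : forall v, uniq (orig v :: stops v);
  stops_last : forall v, last (orig v) (stops v) = dest v;
  capacity_ge2 : (2 <= capacity)%N
}.

Section Instance.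

Variables (R : realFieldType) (N V : finType) (I : instance R N V).
Implicit Types (v u : V) (e : N * N) (dep : V -> R).

Definition route_seq v : seq (N * N) := walk_arcs (orig I v) (stops I v).
Definition route v : {set N * N} := [set e in route_seq v].
Definition arcs : {set N * N} := \bigcup_v route v.
Definition nodes : {set N} := [set e.1 | e in arcs] :|: [set e.2 | e in arcs].

Definition nonneg_savings : Prop :=
  [/\ 0 <= lead_rate I, 0 <= trail_rate I & {in arcs, forall e, 0 <= cost I e}].

Definition uadj : rel N := fun i j => ((i, j) \in arcs) || ((j, i) \in arcs).

(* The first clause excludes a pair of opposite arcs, which would be a pair of
   parallel edges of the undirected counterpart. *)
Definition polytree : Prop :=
  [/\ forall i j, (i, j) \in arcs -> (j, i) \notin arcs,
      {in nodes &, forall i j, connect uadj i j}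
    & forall c : seq N, (2 < size c)%N -> ~ ucycle uadj c].

Definition irreducible_instance : Prop :=
  ~ exists V1 V2 : {set V},
      [/\ V1 != set0 /\ V2 != set0, V1 :&: V2 = set0, V1 :|: V2 = [set: V]
        & (\bigcup_(v in V1) route v) :&: (\bigcup_(v in V2) route v) = set0].

(** Schedules *)

Definition route_time v : R := \sum_(e in route v) travel I e.

Definition feasible dep : Prop :=
  forall v, earliest I v <= dep v /\ dep v + route_time v <= latest I v.

(* As waiting is forbidden, v enters e once it has traversed the arcs that
   precede e on its route. *)
Definition entry_time dep v e : R :=
  dep v + \sum_(a <- take (index e (route_seq v)) (route_seq v)) travel I a.

Definition users e : {set V} := [set v | e \in route v].

(** Platoons: [P e] is the set of platoons on arc e, where a vehicle that
    travels alone is a platoon of size one. *)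

Definition platoon_mates (P : N * N -> {set {set V}}) : rel V := fun u v =>
  [exists e in arcs, exists A in P e, (u \in A) && (v \in A)].

(* Two vehicles are coordinated when a chain of common platoons, possibly on
   different arcs, links them. *)
Definition coordinated (P : N * N -> {set {set V}}) : rel V :=
  connect (platoon_mates P).

(* The last clause is the convention behind the variables z, y and q of the
   assignment formulation below: coordinated vehicles fill up their platoons,
   so that on each arc they form full-size platoons and at most one unsaturated
   one. It does not force vehicles that enter an arc at the same time to be
   coordinated. Without it, four vehicles with capacity 3 could travel as 2 + 2
   on one arc and three of them as a single platoon on the next arc, which the
   formulation cannot represent. *)
Definition platooning dep (P : N * N -> {set {set V}}) : Prop :=
  forall e, e \in arcs ->
  [/\ partition (P e) (users e),
      forall A, A \in P e -> (#|A| <= capacity I)%N,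
      forall A, A \in P e ->
        {in A &, forall u v, entry_time dep u e = entry_time dep v e}
    & forall A B, A \in P e -> B \in P e ->
        (#|A| < capacity I)%N -> (#|B| < capacity I)%N ->
        forall u v, u \in A -> v \in B -> coordinated P u v -> A = B].

Definition platoon_saving e (A : {set V}) : R :=
  if (2 <= #|A|)%N then
    lead_rate I * cost I e + (trail_rate I * cost I e) *+ (#|A| - 1)
  else 0.

Definition total_saving (P : N * N -> {set {set V}}) : R :=
  \sum_(e in arcs) \sum_(A in P e) platoon_saving e A.

(* A solution consists of departure times; its value is the best total saving
   of a platooning that these departure times permit. *)
Definition optimal_schedule dep : Prop :=
  feasible dep /\
  exists2 P, platooning dep P &
    forall dep' P', feasible dep' -> platooning dep' P' ->
      total_saving P' <= total_saving P.

(** Relative time windows *)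

Definition simple_upath (s d : N) (p : seq N) : bool :=
  [&& path uadj s p, uniq (s :: p) & last s p == d].

(* The arcs of the undirected path between s and d that point from s to d; a
   simple path has fewer than #|N| steps, whence the bounded sequences. *)
Definition pointing (s d : N) : {set N * N} :=
  [set e in arcs | [exists p : #|N|.-bseq N,
                      simple_upath s d p && (e \in walk_arcs s p)]].

Definition rel_diff (s r : N) : R :=
  \sum_(e in pointing s r) travel I e - \sum_(e in pointing r s) travel I e.

Variable r : N.

Definition rtw_lo v : R := earliest I v + rel_diff (orig I v) r.
Definition rtw_hi v : R := latest I v - route_time v + rel_diff (orig I v) r.
Definition rtw v : interval R := `[rtw_lo v, rtw_hi v].

(** Time buckets, identified by their position in the sorted list of window
    endpoints, so that equal endpoints yield distinct (degenerate) buckets. *)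

Definition endpoints : seq R :=
  sort <=%R ([seq rtw_lo v | v <- enum V] ++ [seq rtw_hi v | v <- enum V]).

Notation position := 'I_((2 * #|V|).-1).
Implicit Types t : position.

Definition bucket t : interval R := `[endpoints`_t, endpoints`_t.+1].

Definition buckets_of u : {set position} :=
  [set t | (bucket t <= rtw u)%O].
Definition buckets : {set position} := \bigcup_u buckets_of u.

Definition bucket_users e t : {set V} := [set u in users e | t \in buckets_of u].

(** The vehicle-to-time-bucket assignment formulation *)

Record va_solution := VASolution {
  va_x : V -> position -> bool;
  va_y : N * N -> position -> bool;
  va_y' : N * N -> position -> bool;
  va_z : N * N -> position -> nat;
  va_q : N * N -> position -> nat;
  va_w : N * N -> position -> nat
}.

Definition va_load (s : va_solution) e t : nat :=
  (\sum_(u in bucket_users e t) va_x s u t)%N.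

Definition va_feasible (s : va_solution) : Prop :=
  (forall u, (\sum_(t in buckets_of u) va_x s u t)%N = 1%N) /\
  (forall e t, e \in arcs -> t \in buckets ->
     let lambda : int := capacity I in
     let load : int := va_load s e t in
     let y : int := va_y s e t in
     let y' : int := va_y' s e t in
     let z : int := va_z s e t in
     let q : int := va_q s e t in
     let w : int := va_w s e t in
     [/\ lambda * z - load <= 0,
         1 <= lambda * (z + 1) - load,
         w - load + z + y = 0 &
     [/\ q = load - lambda * z,
         y <= q /\ q <= lambda * y &
         2 * y' <= q /\ y' <= y]]).

Definition va_objective (s : va_solution) : R :=
  \sum_(e in arcs) \sum_(t in buckets)
    (lead_rate I * cost I e * (va_z s e t)%:R
     + lead_rate I * cost I e * (va_y' s e t)%:R
     + trail_rate I * cost I e * (va_w s e t)%:R).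

Definition va_optimal (s : va_solution) : Prop :=
  va_feasible s /\
  forall s', va_feasible s' -> va_objective s' <= va_objective s.

(* The schedule dep arises from the assignment s: relative to r, every vehicle
   departs within its bucket, simultaneously with all vehicles assigned to the
   same bucket. *)
Definition arises_from (s : va_solution) dep : Prop :=
  let reldep u := dep u + rel_diff (orig I u) r in
  (forall u t, t \in buckets_of u -> va_x s u t -> reldep u \in bucket t) /\
  (forall u v t, t \in buckets_of u -> t \in buckets_of v ->
     va_x s u t -> va_x s v t -> reldep u = reldep v).

End Instance.

(* Main.v *)
Require Import Defs.
From mathcomp Require Import all_boot all_order all_algebra zify ring.

Set Implicit Arguments.
Unset Strict Implicit.
Unset Printing Implicit Defensive.

Import Order.TTheory GRing.Theory Num.Theory.
Local Open Scope ring_scope.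

(** Call the departure time of a vehicle, shifted by the relative time
difference of its origin, its relative departure time. On a polytree the
relative time difference is a potential: it drops by the travel time along
every arc ([rel_diff_arc]). Hence vehicles sharing an arc enter it
simultaneously exactly when their relative departure times agree
([entry_timeE]), and only the assignment of vehicles to time buckets matters.
To an assignment, [assignment_saving] associates the saving obtained when, on
every arc, the vehicles of each bucket form full-size platoons and at most one
unsaturated one. Both problems are compared with the maximum of this quantity.

On the side of the formulation, the constraints determine all variables but y'
from the assignment, and the value of y' is best when it records whether the
unsaturated platoon has size at least two. So the objective is at most
[assignment_saving], with equality for a suitable solution
([va_feasible_assignment], [assignment_va_solution]).

On the side of the schedules, an assignment is realised by letting every vehicle
depart, in relative time, at the left end of its bucket
([departure_platooning]). Conversely, all members of a class of coordinated
vehicles have the same relative departure time, so that their windows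
intersect. The class is moved to the left, to the largest lower end of the
windows of its members, and is assigned to the bucket that this very endpoint
opens in the sorted list ([platooning_assignment]). When ties are broken by
putting lower ends before upper ends, this bucket lies in the windows of the
whole class ([nth_slotS]), and distinct classes receive distinct buckets since
distinct endpoints occupy distinct positions ([slot_inj]). As coordinated
vehicles fill up their platoons, no saving changes. That classes do not
share a bucket is essential: merging two unsaturated platoons can lose a lead
vehicle's saving. *)

(** * Simple paths in a tree *)

(** If two simple paths with common ends part at x, their next nodes a and b are
    linked by a path avoiding x, which x closes to a cycle. *)
Lemma acyclic_path_unique (T : finType) (adj : rel T) :
    symmetric adj -> (forall c, (2 < size c)%N -> ~ ucycle adj c) ->
  forall p q x, path adj x p -> uniq (x :: p) -> path adj x q ->
    uniq (x :: q) -> last x p = last x q -> p = q.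
Proof.
move=> adjC acyclic; elim=> [|a p IHp] [|b q] x //=.
- by move=> _ _ _ /andP[xNq _] xE; rewrite xE mem_last in xNq.
- by move=> _ /andP[xNp _] _ _ xE; rewrite -xE mem_last in xNp.
move=> /andP[adj_xa a_p] /andP[xNp p_uniq] /andP[adj_xb b_q] /andP[xNq q_uniq].
have [ab|aNb] := eqVneq a b.
  by move: ab b_q q_uniq => <- a_q q_uniq /(IHp _ _ a_p p_uniq a_q q_uniq) ->.
move=> last_eq; pose avoid := [rel y z | [&& adj y z, y != x & z != x]].
have avoid_path y s : path adj y s -> x \notin y :: s -> path avoid y s.
  move=> y_s xNs; apply: (sub_in_path (P := predC1 x)) y_s.
    by move=> u v; rewrite !inE /= => ux vx ->; rewrite ux vx.
  by apply/allP => u u_s; apply: contraNneq xNs => <-.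
have avoidC : connect_sym avoid.
  by apply: sym_connect_sym => y z /=; rewrite adjC [(y != x) && _]andbC.
have: connect avoid a b.
  apply: (@connect_trans _ _ (last a p)).
    by apply/connectP; exists p => //; apply: avoid_path.
  rewrite avoidC last_eq; apply/connectP; exists q => //.
  exact: avoid_path.
case/connectP=> s /shortenP[{}s' a_s s_uniq _] bE.
have xNs : x \notin a :: s'.
  rewrite inE negb_or; apply/andP; split.
    by move: xNp; rewrite inE negb_or => /andP[].
  elim: s' a {adj_xa a_p xNp p_uniq aNb last_eq IHp s_uniq bE} a_s => //= c s' IHs a.
  by case/andP=> /and3P[_ _ cNx] /IHs; rewrite inE negb_or eq_sym cNx.
case: (acyclic (x :: a :: s')).
  by case: s' bE {a_s s_uniq xNs} => // bE; rewrite bE eqxx in aNb.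
rewrite /ucycle /= adj_xa rcons_path -bE adjC adj_xb xNs.
move: s_uniq => /= ->; rewrite !andbT; apply: sub_path a_s.
by move=> y z /= /and3P[].
Qed.

Lemma mem_walk_arcs (T : eqType) (x : T) p e :
  e \in walk_arcs x p -> (e.1 \in x :: p) && (e.2 \in p).
Proof.
elim: p x => //= y p IHp x; rewrite /walk_arcs /= in_cons.
case/predU1P=> [-> /=|/IHp /andP[e1 e2]]; first by rewrite !inE !eqxx.
by rewrite !in_cons in e1 *; rewrite e1 e2 !orbT.
Qed.

Lemma mem_walk_arcs_rev (T : eqType) (x : T) p e :
  (e \in walk_arcs (last x p) (rev (belast x p))) = ((e.2, e.1) \in walk_arcs x p).
Proof.
have rconsE (y : T) q z : walk_arcs y (rcons q z) = rcons (walk_arcs y q) (last y q, z).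
  by elim: q y => //= b q IHq y; rewrite /walk_arcs /= -/(walk_arcs _ _) IHq.
elim: p x => //= y p IHp x; rewrite rev_cons rconsE mem_rcons in_cons.
have ->: last (last y p) (rev (belast y p)) = y.
  by case: p {IHp} => //= z p; rewrite rev_cons last_rcons.
by rewrite {}IHp /walk_arcs /= in_cons; case: e => a b; rewrite !xpair_eqE andbC.
Qed.

(** * The relative time difference as a potential *)

Section RelativeTime.

Variables (R : realFieldType) (N V : finType) (I : instance R N V).
Hypothesis tree : polytree I.

Lemma uadjC : symmetric (uadj I).
Proof. by move=> i j; rewrite /uadj orbC. Qed.

Lemma simple_upath_unique s d p q :
  simple_upath I s d p -> simple_upath I s d q -> p = q.
Proof.
case: tree => _ _ acyclic /and3P[p1 p2 /eqP p3] /and3P[q1 q2 /eqP q3].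
by apply: (acyclic_path_unique uadjC acyclic p1 p2 q1 q2); rewrite p3.
Qed.

Lemma simple_upath_rev s d p :
  simple_upath I s d p -> simple_upath I d s (rev (belast s p)).
Proof.
case/and3P=> s_p p_uniq /eqP <-; apply/and3P; split.
- by rewrite rev_path (eq_path (e' := uadj I)) // => x y /=; rewrite uadjC.
- by rewrite -rev_rcons rev_uniq -lastI.
- by case: p {s_p p_uniq} => //= a p; rewrite rev_cons last_rcons.
Qed.

Lemma mem_pointing s d p e :
  simple_upath I s d p ->
  (e \in pointing I s d) = (e \in arcs I) && (e \in walk_arcs s p).
Proof.
move=> sp; rewrite inE; congr (_ && _); apply/existsP/idP => [[q /andP[sq eq]]|ep].
  by rewrite (simple_upath_unique sp sq).
have size_p : (size p <= #|N|)%N.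
  case/and3P: sp => _ /= /andP[_ p_uniq] _.
  by rewrite -(card_uniqP p_uniq) max_card.
by exists (Bseq size_p); rewrite /= sp.
Qed.

Lemma mem_pointing_rev s d p e : simple_upath I s d p ->
  (e \in pointing I d s) = (e \in arcs I) && ((e.2, e.1) \in walk_arcs s p).
Proof.
move=> sp; rewrite (mem_pointing _ (simple_upath_rev sp)) -mem_walk_arcs_rev.
by case/and3P: sp => _ _ /eqP ->.
Qed.

Lemma rel_diff_step i j r p : simple_upath I i r (j :: p) ->
  rel_diff I i r =
    (if (i, j) \in arcs I then travel I (i, j) else 0)
    - (if (j, i) \in arcs I then travel I (j, i) else 0) + rel_diff I j r.
Proof.
move=> ip; have jp : simple_upath I j r p.
  by case/and3P: ip => /= /andP[_ ?] /andP[_ ?] ?; apply/and3P.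
(* The node i is not revisited, so the first step contributes a new arc. *)
have i_fresh e : e \in walk_arcs j p -> (e.1 != i) && (e.2 != i).
  case/and3P: ip => _ /= /andP[iNp _] _ /mem_walk_arcs /andP[e1 e2].
  by rewrite !(contraNneq _ iNp) // => <-; rewrite // inE e2 orbT.
have split_sum (S S' : {set N * N}) a (b : bool) : (b -> a \notin S') ->
    (forall e, (e \in S) = (b && (e == a)) || (e \in S')) ->
    \sum_(e in S) travel I e = (if b then travel I a else 0) + \sum_(e in S') travel I e.
  case: b => [/(_ isT) aN|_] SE; last by rewrite add0r; apply: eq_bigl => e; rewrite SE.
  rewrite (eq_bigl (mem (a |: S'))) ?big_setU1 // => e.
  by rewrite SE inE /= !inE.
rewrite /rel_diff (split_sum _ (pointing I j r) (i, j) ((i, j) \in arcs I)); first last.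
- move=> e; rewrite (mem_pointing _ ip) (mem_pointing _ jp) /walk_arcs /= in_cons.
  by rewrite andb_orr; case: eqP => [->|_] //; rewrite !andbF.
- by move=> _; rewrite (mem_pointing _ jp) negb_and; apply/orP; right;
     apply/negP => /i_fresh; rewrite eqxx.
rewrite (split_sum (pointing I r i) (pointing I r j) (j, i)
  ((j, i) \in arcs I)); first last.
- move=> [a b]; rewrite (mem_pointing_rev _ ip) (mem_pointing_rev _ jp) /walk_arcs /=.
  rewrite in_cons andb_orr; have -> : ((b, a) == (i, j)) = ((a, b) == (j, i)).
    by rewrite !xpair_eqE andbC.
  by case: eqP => [->|_] //; rewrite !andbF.
- by move=> _; rewrite (mem_pointing_rev _ jp) negb_and; apply/orP; right;
     apply/negP => /i_fresh; rewrite eqxx.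
by rewrite opprD !addrA; congr (_ + _); rewrite addrAC.
Qed.

(** One end of the arc lies on the simple path from the other end to r, which
    therefore starts with the arc, in one direction or the other. *)
Lemma rel_diff_arc r i j : r \in nodes I -> (i, j) \in arcs I ->
  rel_diff I i r = travel I (i, j) + rel_diff I j r.
Proof.
move=> r_node ij; case: tree => one_way conn acyclic.
have jiN := negbTE (one_way _ _ ij).
have iNj : i != j by apply/eqP => ijE; move: (ij) jiN; rewrite ijE => ->.
have j_node : j \in nodes I.
  by rewrite inE; apply/orP; right; apply/imsetP; exists (i, j).
have adj_ij : uadj I i j by rewrite /uadj ij.
case/connectP: (conn _ _ j_node r_node) => p0 /shortenP[p jp p_uniq _] rE.
have [ip|iNp] := boolP (i \in j :: p); last first.
  have /rel_diff_step -> : simple_upath I i r (j :: p).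
    by apply/and3P; split; [rewrite /= adj_ij | rewrite cons_uniq iNp | rewrite /= -rE].
  by rewrite ij jiN subr0.
rewrite inE (negbTE iNj) /= in ip.
case/splitPr: ip jp p_uniq rE => [[|a p1] p2] jp p_uniq rE.
  have /rel_diff_step -> : simple_upath I j r (i :: p2).
    by apply/and3P; split; rewrite ?jp // -rE.
  by rewrite ij jiN sub0r addrA subrr add0r.
(* The path from j meets i after at least one other node: the arc from i to j
   closes a cycle. *)
case: (acyclic (j :: rcons (a :: p1) i)); first by rewrite /= size_rcons.
rewrite -cat_rcons cat_path -cat_cons cat_uniq in jp p_uniq.
case/andP: jp => jp _; case/and3P: p_uniq => p_uniq _ _.
by rewrite /ucycle /cycle rcons_path jp last_rcons adj_ij.
Qed.

Lemma route_arcs v e : e \in route I v -> e \in arcs I.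
Proof. by move=> ev; apply/bigcupP; exists v. Qed.

Lemma entry_timeE r dep v e : r \in nodes I -> e \in route I v ->
  entry_time I dep v e = dep v + rel_diff I (orig I v) r - rel_diff I e.1 r.
Proof.
move=> r_node ev; rewrite /entry_time -addrA; congr (_ + _).
have: {subset route_seq I v <= arcs I}.
  by move=> a av; apply: (@route_arcs v); rewrite inE.
rewrite inE in ev; move: ev; rewrite /route_seq.
elim: (stops I v) (orig I v) => [|y p IHp] x //; rewrite /walk_arcs /= -/(walk_arcs y p).
move=> ep sub; have xy := sub _ (mem_head _ _).
have [<-|xyNe] := eqVneq (x, y) e; first by rewrite big_nil subrr.
rewrite inE eq_sym (negbTE xyNe) /= in ep.
rewrite big_cons IHp //; first by rewrite (rel_diff_arc r_node xy) addrA.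
by move=> a ap; apply: sub; rewrite inE ap orbT.
Qed.

End RelativeTime.

(** * Buckets opened by the lower ends of the windows *)

Section Slots.

Variables (R : realFieldType) (V : finType) (lo hi : V -> R).

Let ends : seq R :=
  sort <=%R ([seq lo v | v <- enum V] ++ [seq hi v | v <- enum V]).

Lemma size_ends : size ends = (2 * #|V|)%N.
Proof. by rewrite size_sort size_cat !size_map -enumT -cardE addnn mul2n. Qed.

Lemma sorted_ends : sorted <=%O ends.
Proof. exact: (sort_sorted (@le_total _ R)). Qed.

Lemma count_ends (p : pred R) :
  count p ends = (#|[set v | p (lo v)]| + #|[set v | p (hi v)]|)%N.
Proof.
have count_enum f : count p [seq f v | v <- enum V] = #|[set v | p (f v)]|.
  by rewrite count_map cardE -size_filter /enum_mem -filter_predI; congr size;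
     apply: eq_filter => v; rewrite /= inE andbT.
by rewrite count_sort count_cat !count_enum.
Qed.

(** A strict total order on the lower ends, ties being broken by the enumeration
    of the vehicles. *)
Definition earlier (u v : V) : bool :=
  (lo u < lo v) || (lo u == lo v) && (enum_rank u < enum_rank v)%N.

(** The position of the lower end of u in the sorted list of all endpoints when,
    at equal values, lower ends come before upper ends. *)
Definition slot (u : V) : nat :=
  (#|[set v | earlier v u]| + #|[set v | (hi v < lo u)%R]|)%N.

Lemma earlier_slot u v : earlier u v -> (slot u < slot v)%N.
Proof.
move=> uv; have lo_uv : lo u <= lo v by case/orP: uv => [/ltW|/andP[/eqP-> _]].
rewrite /slot -addSn leq_add //; last first.
  by apply/subset_leq_card/subsetP => w; rewrite !inE => /lt_le_trans; apply.
apply/proper_card/properP; split.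
  apply/subsetP => w; rewrite !inE => wu; case/orP: wu uv => [wu _|/andP[/eqP wu rk_wu]].
    by rewrite /earlier (lt_le_trans wu).
  case/orP=> [uv|/andP[/eqP uv rk_uv]]; rewrite /earlier wu ?uv //.
  by rewrite eqxx (ltn_trans rk_wu rk_uv) orbT.
by exists u; rewrite !inE // /earlier ltxx ltnn andbF.
Qed.

Lemma slot_inj : injective slot.
Proof.
move=> u v /eqP; apply: contraTeq => uNv; rewrite neq_ltn.
suff /orP[] : earlier u v || earlier v u by move/earlier_slot => ->; rewrite ?orbT.
rewrite /earlier; case: ltgtP => //= _.
by rewrite -neq_ltn; apply: contra uNv => /eqP/val_inj/enum_rank_inj/eqP.
Qed.

Lemma card_earlier u x : lo u <= x ->
  (#|[set w | earlier w u]| < #|[set w | (lo w <= x)%R]|)%N.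
Proof.
move=> uv; apply/proper_card/properP; split.
  apply/subsetP => w; rewrite !inE => /orP[/ltW wu|/andP[/eqP -> _]] //.
  exact: le_trans uv.
by exists u; rewrite !inE // /earlier ltxx ltnn andbF.
Qed.

Lemma nth_slot u : ends`_(slot u) = lo u.
Proof.
apply: nth_count_eq sorted_ends _; rewrite !count_ends /slot; apply/andP; split.
  apply: leq_add => //; apply/subset_leq_card/subsetP => w; rewrite !inE.
  by rewrite /earlier => ->.
rewrite -addSn; apply: leq_add; first exact: card_earlier.
by apply/subset_leq_card/subsetP => w; rewrite !inE => /ltW.
Qed.

Lemma slotS_count u v : lo u <= hi v -> ((slot u).+1 < count (<= hi v)%R ends)%N.
Proof.
move=> uv; rewrite count_ends /slot -addSn -addnS; apply: leq_add.
  exact: card_earlier.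
apply/proper_card/properP; split.
  by apply/subsetP => w; rewrite !inE => /ltW/le_trans; apply.
by exists v; rewrite !inE ?lexx // -leNgt.
Qed.

Lemma slotS_lt u v : lo u <= hi v -> ((slot u).+1 < 2 * #|V|)%N.
Proof. by move/slotS_count/leq_trans; apply; rewrite -size_ends count_size. Qed.

(** A window that contains the lower end of u contains the whole bucket opened by
    that lower end: its upper end comes later in the list. *)
Lemma nth_slotS u v : lo u <= hi v -> ends`_(slot u).+1 <= hi v.
Proof. by move/slotS_count; apply: nth_count_le sorted_ends. Qed.

End Slots.

(** * Full-size platoons and one unsaturated platoon *)

Section Filling.

Variable V : finType.
Implicit Types (P : {set {set V}}) (D A B : {set V}).

(** The blocks of P have size at most c, lie within fibres of tau, and each fibre
    contains at most one block that is not of size c. *)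
Definition filled (T : eqType) (tau : V -> T) (c : nat) P : Prop :=
  [/\ forall A, A \in P -> (#|A| <= c)%N,
      forall A, A \in P -> {in A &, forall u v, tau u = tau v}
    & forall A B, A \in P -> B \in P -> (#|A| < c)%N -> (#|B| < c)%N ->
        forall u v, u \in A -> v \in B -> tau u = tau v -> A = B].

Lemma exists_subset_card D n : (n <= #|D|)%N ->
  exists2 A : {set V}, A \subset D & #|A| = n.
Proof.
move=> nD; exists [set x | x \in take n (enum D)].
  by apply/subsetP => x; rewrite inE => /mem_take; rewrite mem_enum.
by rewrite cardsE (card_uniqP (take_uniq _ (enum_uniq _))) size_takel // -cardE.
Qed.

Lemma filled_partition_exists (T : eqType) (tau : V -> T) c D : (0 < c)%N ->
  exists P, partition P D /\ filled tau c P.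
Proof.
move=> c_gt0; have [m] := ubnP #|D|; elim: m D => // m IHm D leDm.
have [->|[u uD]] := set_0Vmem D.
  exists set0; rewrite partition_set0 eqxx; split=> //.
  by split=> [A|A|A B]; rewrite inE.
pose Du := [set v in D | tau v == tau u].
have [A A_Du cardA] : exists2 A : {set V}, A \subset Du & #|A| = minn c #|Du|.
  exact: exists_subset_card (geq_minr _ _).
have Du_gt0 : (0 < #|Du|)%N by apply/card_gt0P; exists u; rewrite !inE uD eqxx.
have A_gt0 : (0 < #|A|)%N by rewrite cardA leq_min c_gt0.
have DuD : Du \subset D by apply/subsetP => v; rewrite inE => /andP[].
have AD : A \subset D := subset_trans A_Du DuD.
have tauA v : v \in A -> tau v = tau u.
  by move/(subsetP A_Du); rewrite inE => /andP[_ /eqP].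
have [|P [P_part [P_le P_tau P_uniq]]] := IHm (D :\: A).
  rewrite -ltnS (leq_trans _ leDm) // ltnS.
  by rewrite cardsD (setIidPr AD) ltn_subrL A_gt0 (leq_trans A_gt0) // subset_leq_card.
exists (A |: P); split.
  rewrite -(setID D A) (setIidPr AD); apply: partitionU1 => //.
    by rewrite -card_gt0.
  by rewrite disjoint_sym disjoints_subset; apply/subsetP => v; rewrite !inE => /andP[].
(* When A is not full, it exhausts the elements of D with the value tau u. *)
have only_A B v : (#|A| < c)%N -> B \in P -> v \in B -> tau v <> tau u.
  rewrite cardA => Ac BP vB tau_v; have /andP[vNA vD] : (v \notin A) && (v \in D).
    by have := partitionS P_part BP; move/subsetP/(_ v vB); rewrite inE.
  have /eqP AE : A == Du.
    rewrite eqEcard A_Du cardA leq_min leqnn andbT.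
    by move: Ac; rewrite gtn_min ltnn => /ltnW.
  by rewrite AE !inE vD tau_v eqxx in vNA.
split=> [B|B|B C]; rewrite !inE.
- by case/predU1P=> [->|/P_le //]; rewrite cardA geq_minl.
- by case/predU1P=> [-> v w vA wA|/P_tau //]; rewrite !tauA.
case/predU1P=> [->|BP]; case/predU1P=> [->|CP] // Bc Cc v w vB wC tau_vw.
- by case: (only_A _ _ Bc CP wC); rewrite -tau_vw tauA.
- by case: (only_A _ _ Cc BP vB); rewrite tau_vw tauA.
- exact: (P_uniq B C BP CP Bc Cc v w).
Qed.

End Filling.

Section Saving.

Variables (R : realFieldType) (N V : finType) (I : instance R N V).
Implicit Types (P : {set {set V}}) (D A B : {set V}).

(** The saving on e of n vehicles that form as many full-size platoons as
    possible and a single platoon with the remaining vehicles. *)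
Definition group_saving (e : N * N) (n : nat) : R :=
  lead_rate I * cost I e * (n %/ capacity I)%:R
  + lead_rate I * cost I e * (1 < n %% capacity I)%N%:R
  + trail_rate I * cost I e * (n - n %/ capacity I - (0 < n %% capacity I))%N%:R.

Lemma capacity_gt0 : (0 < capacity I)%N.
Proof. exact: leq_trans (capacity_ge2 I). Qed.

Lemma full_platoons_saving e P : {in P, forall A, #|A| = capacity I} ->
  \sum_(A in P) platoon_saving I e A =
    lead_rate I * cost I e * #|P|%:R
    + trail_rate I * cost I e * (#|P| * (capacity I).-1)%N%:R.
Proof.
move=> P_full; rewrite (eq_bigr (fun=> lead_rate I * cost I e
    + trail_rate I * cost I e *+ (capacity I).-1)); last first.
  by move=> A AP; rewrite /platoon_saving P_full // capacity_ge2 subn1.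
by rewrite sumr_const mulrnDl -mulrnA mulnC !mulr_natr.
Qed.

Lemma single_group_saving e P D : partition P D ->
    (forall A, A \in P -> (#|A| <= capacity I)%N) ->
    (forall A B, A \in P -> B \in P -> (#|A| < capacity I)%N ->
       (#|B| < capacity I)%N -> A = B) ->
  \sum_(A in P) platoon_saving I e A = group_saving e #|D|.
Proof.
move=> P_part P_le P_uniq; have c_gt0 := capacity_gt0.
have [/existsP[A0 /andP[A0P A0c]]|noneP] := boolP [exists A in P, #|A| < capacity I]%N.
  have Q_part := partitionD1 P_part A0P.
  have Q_full : {in P :\ A0, forall A, #|A| = capacity I}.
    move=> A; rewrite !inE => /andP[ANA0 AP]; apply/eqP.
    rewrite eqn_leq P_le //= leqNgt; apply: contra ANA0 => Ac.
    by apply/eqP/P_uniq.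
  have A0_gt0 : (0 < #|A0|)%N.
    by rewrite card_gt0; apply: contraTneq A0P => ->; case/and3P: P_part.
  have A0D : A0 \subset D := partitionS P_part A0P.
  have cardD : #|D| = (#|P :\ A0| * capacity I + #|A0|)%N.
    by rewrite -(card_uniform_partition Q_full Q_part) -(cardsID A0 D)
               (setIidPr A0D) addnC.
  rewrite (big_setD1 _ A0P) (full_platoons_saving _ Q_full) /group_saving cardD.
  rewrite divnMDl // divn_small // addn0 modnMDl modn_small // A0_gt0.
  set k := #|P :\ A0|; have -> : (k * capacity I + #|A0| - k - 1 =
      k * (capacity I).-1 + (#|A0| - 1))%N.
    by rewrite -[in LHS](prednK c_gt0) mulnS -addnA addKn addnBA.
  rewrite natrD; rewrite /platoon_saving; case: ltnP => A0_1 /=.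
    by rewrite -mulr_natr; ring.
  have -> : (#|A0| - 1 = 0)%N by apply/eqP; rewrite subn_eq0.
  by ring.
have P_full : {in P, forall A, #|A| = capacity I}.
  move=> A AP; apply/eqP; rewrite eqn_leq P_le //= leqNgt.
  by apply: contra noneP => Ac; apply/existsP; exists A; rewrite AP.
rewrite (full_platoons_saving _ P_full) /group_saving.
rewrite (card_uniform_partition P_full P_part) mulnK // modnMl mulr0 addr0 subn0.
by rewrite -[X in (_ - X)%N]muln1 -mulnBr subn1.
Qed.

Lemma saving_by_group (T : finType) (tau : V -> T) e P D :
    partition P D -> filled tau (capacity I) P ->
  \sum_(A in P) platoon_saving I e A =
    \sum_t group_saving e #|[set u in D | tau u == t]|.
Proof.
move=> P_part [P_le P_tau P_uniq].
pose Dt t := [set u in D | tau u == t]; pose Pt t := [set A in P | A \subset Dt t].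
have tau_of A : A \in P -> exists2 u, u \in A & forall t, (A \subset Dt t) = (t == tau u).
  move=> AP; have /set0Pn[u uA] : A != set0.
    by apply: contraTneq AP => ->; case/and3P: P_part.
  exists u => // t; apply/subsetP/eqP => [/(_ u uA)|-> v vA].
    by rewrite inE => /andP[_ /eqP].
  by rewrite inE (subsetP (partitionS P_part AP)) //= (P_tau A AP v u).
have Pt_part t : partition (Pt t) (Dt t).
  case/and3P: (P_part) => /eqP coverP trivP P0; apply/and3P; split.
  - apply/eqP/setP => u; apply/bigcupP/idP => [[A]|uDt].
      by rewrite inE => /andP[_ /subsetP]; apply.
    have /andP[uD /eqP tau_u] : (u \in D) && (tau u == t) by rewrite inE in uDt.
    have : u \in cover P by rewrite coverP.
    case/bigcupP=> A AP uA; exists A => //; rewrite inE AP.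
    have [v vA ->] := tau_of A AP; rewrite -tau_u; apply/eqP.
    exact: (P_tau A AP).
  - by apply: trivIsetS trivP; apply/subsetP => A; rewrite inE => /andP[].
  - by rewrite inE (negbTE P0).
have PtE t : \sum_(A in Pt t) platoon_saving I e A = group_saving e #|Dt t|.
  apply: single_group_saving (Pt_part t) _ _ => [A|A B]; rewrite inE => /andP[AP AD].
    exact: P_le.
  rewrite inE => /andP[BP BD] Ac Bc; have [u uA AE] := tau_of A AP.
  have [v vB BE] := tau_of B BP; apply: (P_uniq _ _ AP BP Ac Bc u v uA vB).
  by rewrite AE in AD; rewrite BE in BD; rewrite -(eqP AD) (eqP BD).
under [RHS]eq_bigr => t _ do rewrite -PtE.
rewrite (exchange_big_dep (mem P)) /=; last by move=> t A _; rewrite inE => /andP[].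
apply: eq_bigr => A AP; have [u uA AE] := tau_of A AP.
by rewrite (big_pred1 (tau u)) // => t; rewrite inE AP AE.
Qed.

End Saving.

(** * Savings of assignments to buckets *)

Section Formulation.

Variables (R : realFieldType) (N V : finType) (I : instance R N V) (r : N).
Notation position := 'I_((2 * #|V|).-1).
Implicit Types (tau : V -> position) (t : position) (s : va_solution N V).

(** Every vehicle is assigned to a bucket contained in its window. *)
Definition valid_assignment tau : Prop := forall u, tau u \in buckets_of I r u.

(** The vehicles taking e in the bucket t. *)
Definition group tau e t : {set V} := [set u in users I e | tau u == t].

(** The total saving when the vehicles of each bucket fill up their platoons. The
    sum runs over all positions, as those outside the collection of buckets
    receive no vehicle from a valid assignment. *)
Definition assignment_saving tau : R :=
  \sum_(e in arcs I) \sum_t group_saving I e #|group tau e t|.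

Lemma size_endpoints : size (endpoints I r) = (2 * #|V|)%N.
Proof. exact: size_ends. Qed.

Lemma sorted_endpoints : sorted <=%O (endpoints I r).
Proof. exact: sorted_ends. Qed.

Lemma bucket_le t : (endpoints I r)`_t <= (endpoints I r)`_t.+1.
Proof.
apply: le_sorted_leq_nth; rewrite ?sorted_endpoints ?inE //.
all: rewrite size_endpoints; have := ltn_ord t; lia.
Qed.

Lemma mem_buckets_of t u : (t \in buckets_of I r u) =
  (rtw_lo I r u <= (endpoints I r)`_t) && ((endpoints I r)`_t.+1 <= rtw_hi I r u).
Proof. by rewrite inE subitvE !bnd_simp. Qed.

Lemma sum_group_saving_buckets tau e : valid_assignment tau ->
  \sum_(t in buckets I r) group_saving I e #|group tau e t| =
    \sum_t group_saving I e #|group tau e t|.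
Proof.
move=> tauP; apply: big_rmcond => t tN; have -> : group tau e t = set0.
  apply/setP => u; rewrite !inE; apply: contraNF tN => /andP[_ /eqP <-].
  by apply/bigcupP; exists u.
by rewrite cards0 /group_saving div0n mod0n !mulr0 !addr0.
Qed.

Lemma va_loadE tau s : valid_assignment tau ->
    (forall u t, t \in buckets_of I r u -> va_x s u t = (tau u == t)) ->
  forall e t, va_load I r s e t = #|group tau e t|.
Proof.
move=> tauP sE e t; rewrite /va_load -sum1_card big_mkcond [RHS]big_mkcond.
apply: eq_bigr => u _; rewrite !inE; case: (e \in route_seq I u) => //=.
have [t_u|tN] := boolP (bucket I r t <= rtw I r u)%O; rewrite ?andbF ?andbT /=.
  by rewrite sE ?inE //; case: eqP.
by case: eqP => // tE; have := tauP u; rewrite tE inE (negbTE tN).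
Qed.

(** The constraints on an arc and a bucket with load n determine z, y and w
    from n and the capacity c, and bound y' from above. *)
Lemma va_counts (c n z q w : nat) (y y' : bool) : (0 < c)%N ->
    (c%:Z * z%:Z = n%:Z - q%:Z) -> (1 <= c%:Z * (z%:Z + 1) - n%:Z) ->
    (w%:Z - n%:Z + z%:Z + y%:Z = 0) -> y%:Z <= q%:Z -> q%:Z <= c%:Z * y%:Z ->
    2 * y'%:Z <= q%:Z ->
  [/\ z = n %/ c, y = (0 < n %% c), (y' -> 1 < n %% c) & w = n - n %/ c - (0 < n %% c)]%N.
Proof.
move=> c_gt0 nE zc wE yq qy y'q.
have nE' : n = (z * c + q)%N by nia.
have qc : (q < c)%N by nia.
have [zE qE] : z = (n %/ c)%N /\ q = (n %% c)%N.
  by rewrite nE' divnMDl // modnMDl divn_small // modn_small // addn0.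
rewrite -zE -qE; have yE : y = (0 < q)%N.
  by case: (y) yq qy {wE} => /=; case: q qc {nE nE' y'q qE} => //=; nia.
by split=> //; [move=> y'T; rewrite y'T in y'q; lia | rewrite -yE; lia].
Qed.


(** * Solutions of the assignment formulation *)

Lemma va_feasible_assignment s : nonneg_savings I -> va_feasible I r s ->
  exists tau, [/\ valid_assignment tau,
    forall u t, t \in buckets_of I r u -> va_x s u t = (tau u == t)
    & va_objective I r s <= assignment_saving tau].
Proof.
move=> [lead_ge0 trail_ge0 cost_ge0] [x_sum s_cons].
have /fin_all_exists[tau tauP] u : exists t, t \in buckets_of I r u /\
    forall t', t' \in buckets_of I r u -> va_x s u t' = (t == t').
  have /eqP/sum_nat_eq1[t [tu xt x0]] := x_sum u; exists t; split=> // t' t'u.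
  have [<-|t'Nt] := eqVneq t t'; first by move: xt; case: (va_x s u t).
  by move: (x0 t'); rewrite eq_sym => /(_ t'Nt t'u); case: (va_x s u t').
have tau_valid : valid_assignment tau by move=> u; case: (tauP u).
have xE u t : t \in buckets_of I r u -> va_x s u t = (tau u == t).
  by case: (tauP u) => _; apply.
exists tau; split=> //; apply: ler_sum => e e_arc.
rewrite -sum_group_saving_buckets //; apply: ler_sum => t t_bucket.
have [_ z_le w_eq [q_eq [yq qy] [y'q _]]] := s_cons e t e_arc t_bucket.
rewrite (va_loadE tau_valid xE) in z_le w_eq q_eq.
have cz : (capacity I)%:Z * (va_z s e t)%:Z
    = #|group tau e t|%:Z - (va_q s e t)%:Z by rewrite q_eq; lia.
have [zE _ y'P wE] := va_counts (capacity_gt0 I) cz z_le w_eq yq qy y'q.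
rewrite /group_saving zE wE !lerD2r lerD2l ler_wpM2l ?mulr_ge0 ?cost_ge0 //.
by rewrite ler_nat; case: (va_y' s e t) y'P => // ->.
Qed.

Lemma assignment_va_solution tau : valid_assignment tau ->
  exists2 s, va_feasible I r s & va_objective I r s = assignment_saving tau.
Proof.
move=> tauP; pose c := capacity I; pose n e t := #|group tau e t|.
pose s := VASolution (fun u t => tau u == t) (fun e t => 0 < n e t %% c)%N
  (fun e t => 1 < n e t %% c)%N (fun e t => n e t %/ c)%N (fun e t => n e t %% c)%N
  (fun e t => n e t - n e t %/ c - (0 < n e t %% c))%N.
exists s; last first.
  by apply: eq_bigr => e e_arc; rewrite -sum_group_saving_buckets //; apply: eq_bigr.
split=> [u|e t e_arc _].
  apply/eqP/sum_nat_eq1; exists (tau u); split=> //=; first by rewrite eqxx.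
  by move=> t tNu _; rewrite eq_sym (negbTE tNu).
rewrite (@va_loadE tau) //= -/(n e t) -/c.
have c_ge2 : (2 <= c)%N := capacity_ge2 I.
have nE := divn_eq (n e t) c; have mod_lt : (n e t %% c < c)%N by rewrite ltn_mod; lia.
move: (n e t) (n e t %/ c)%N (n e t %% c)%N nE mod_lt => m z q nE mod_lt.
have zq : (z <= z * c)%N by rewrite leq_pmulr //; lia.
have {}nE : m%:Z = c%:Z * z%:Z + q%:Z by rewrite nE PoszD PoszM mulrC.
have zq' : z%:Z <= c%:Z * z%:Z by rewrite mulrC -PoszM.
have zS : c%:Z * (z%:Z + 1) = c%:Z * z%:Z + c%:Z by rewrite mulrDr mulr1.
rewrite {}zS; move: (c%:Z * z%:Z) nE zq' => cz nE zq'.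
by case: q mod_lt nE => [|[|q]] /= mod_lt nE; split; try split; lia.
Qed.

(** * Schedules *)

(** In relative time, every vehicle departs at the left end of its bucket. *)
Definition departure tau u : R := (endpoints I r)`_(tau u) - rel_diff I (orig I u) r.

Lemma departure_in_window tau u : valid_assignment tau ->
  rtw_lo I r u <= (endpoints I r)`_(tau u) /\ (endpoints I r)`_(tau u) <= rtw_hi I r u.
Proof.
move=> /(_ u); rewrite mem_buckets_of => /andP[lo_le hi_ge]; split=> //.
apply: le_trans hi_ge; exact: bucket_le.
Qed.

Lemma departure_feasible tau : valid_assignment tau -> feasible I (departure tau).
Proof.
move=> tauP u; have [] := departure_in_window u tauP.
rewrite /rtw_lo /rtw_hi /departure; split; first by rewrite lerBrDr.
by rewrite -lerBrDr lerBlDr.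
Qed.

Lemma departure_arises tau s : valid_assignment tau ->
    (forall u t, t \in buckets_of I r u -> va_x s u t = (tau u == t)) ->
  arises_from I r s (departure tau).
Proof.
move=> tauP sE; split=> [u t tu|u v t tu tv].
  rewrite sE // => /eqP <-; rewrite /departure subrK in_itv /= lexx /=.
  exact: bucket_le.
by rewrite !sE // => /eqP <- /eqP tau_vu; rewrite /departure !subrK tau_vu.
Qed.

Lemma coordinated_invariant (T : Type) (f : V -> T) (P : N * N -> {set {set V}}) :
    (forall e A, e \in arcs I -> A \in P e -> {in A &, forall u v, f u = f v}) ->
  forall u v, coordinated I P u v -> f u = f v.
Proof.
move=> fP u v /connectP[p]; elim: p u => [|w p IHp] u /=; first by move=> _ ->.
case/andP=> /existsP[e /andP[e_arc /existsP[A /andP[AP /andP[uA wA]]]]].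
move=> w_p /(IHp _ w_p) <-.
exact: fP e_arc AP _ _ uA wA.
Qed.

Lemma departure_platooning tau : polytree I -> r \in nodes I -> valid_assignment tau ->
  exists2 P, platooning I (departure tau) P & total_saving I P = assignment_saving tau.
Proof.
move=> tree r_node tauP.
have /fin_all_exists[P PP] e := filled_partition_exists tau (users I e) (capacity_gt0 I).
exists P; last first.
  apply: eq_bigr => e _; have [P_part P_fill] := PP e.
  exact: saving_by_group P_part P_fill.
have coordP u v : coordinated I P u v -> tau u = tau v.
  by apply: coordinated_invariant => e A _ AP; have [_ [_ P_tau _]] := PP e; apply: P_tau.
move=> e e_arc; have [P_part [P_le P_tau P_uniq]] := PP e; split=> //.
  move=> A AP u v uA vA.
  have routeP w : w \in A -> e \in route I w.
    by move/(subsetP (partitionS P_part AP)); rewrite inE.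
  rewrite !(entry_timeE tree _ r_node) ?routeP // /departure !subrK.
  by rewrite (P_tau A AP u v uA vA).
move=> A B AP BP Ac Bc u v uA vB /coordP uv; exact: P_uniq Ac Bc u v uA vB uv.
Qed.

(** Each class of coordinated vehicles is assigned to the bucket opened by the
    largest lower end of the windows of its members. *)
Lemma platooning_assignment dep P : polytree I -> r \in nodes I ->
    feasible I dep -> platooning I dep P ->
  exists2 tau, valid_assignment tau & total_saving I P = assignment_saving tau.
Proof.
move=> tree r_node dep_ok P_ok; pose rel u := dep u + rel_diff I (orig I u) r.
have rel_coord : forall u v, coordinated I P u v -> rel u = rel v.
  apply: coordinated_invariant => e A e_arc AP u v uA vA.
  have [P_part _ P_sync _] := P_ok e e_arc.
  have routeP w : w \in A -> e \in route I w.
    by move/(subsetP (partitionS P_part AP)); rewrite inE.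
  have := P_sync A AP u v uA vA; rewrite !(entry_timeE tree _ r_node) ?routeP //.
  by apply: addIr.
have rel_window u : rtw_lo I r u <= rel u <= rtw_hi I r u.
  have [lo_ok hi_ok] := dep_ok u; rewrite /rtw_lo /rtw_hi /rel !lerD2r lo_ok /=.
  by rewrite lerBrDr.
have coordC : connect_sym (platoon_mates I P).
  apply: sym_connect_sym => u v; apply: eq_existsb => e; congr (_ && _).
  by apply: eq_existsb => A; rewrite [(u \in A) && _]andbC.
pose class u := fingraph.root (platoon_mates I P) u.
have classP u v : reflect (class u = class v) (coordinated I P u v).
  exact: fingraph.rootP.
(* The maximum is sought from the canonical member of the class, so that all
   members of a class have the same representative. *)
pose rep u := [arg max_(v > class u | coordinated I P (class u) v) rtw_lo I r v]%O.
have repP u : coordinated I P u (rep u) /\ rtw_lo I r (rep u) <= rel u.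
  have u_class : coordinated I P u (class u) := connect_root _ _.
  rewrite /rep; case: arg_maxP => [|v class_v _]; first exact: connect0.
  have uv := connect_trans u_class class_v; split=> //.
  by rewrite (rel_coord _ _ uv); case/andP: (rel_window v).
have rep_max u v : coordinated I P u v -> rtw_lo I r v <= rtw_lo I r (rep u).
  move=> uv; rewrite /rep; case: arg_maxP => [|w _ wP]; first exact: connect0.
  apply: wP; apply: connect_trans uv.
  by rewrite coordC; apply: connect_root.
have rep_hi u : rtw_lo I r (rep u) <= rtw_hi I r u.
  by case: (repP u) => _ /le_trans; apply; case/andP: (rel_window u).
have slot_lt u : (slot (rtw_lo I r) (rtw_hi I r) (rep u) < (2 * #|V|).-1)%N.
  by have := slotS_lt (rep_hi u); lia.
pose tau u : position := Ordinal (slot_lt u).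
have tau_coord u v : coordinated I P u v <-> tau u = tau v.
  split=> [/classP uv|]; first by apply: val_inj; rewrite /= /rep uv.
  move/(congr1 val) => /= /slot_inj rep_uv.
  apply: connect_trans (repP u).1 _; rewrite rep_uv coordC; exact: (repP v).1.
exists tau.
  move=> u; rewrite mem_buckets_of /= /endpoints nth_slot nth_slotS // andbT.
  exact: rep_max (connect0 _ _).
apply: eq_bigr => e e_arc; have [P_part P_le _ P_uniq] := P_ok e e_arc.
apply: saving_by_group P_part _; split=> // [A AP u v uA vA|A B AP BP Ac Bc u v uA vB].
  apply/tau_coord/connect1/existsP; exists e; rewrite e_arc.
  by apply/existsP; exists A; rewrite AP uA.
by move/tau_coord; apply: P_uniq AP BP Ac Bc u v uA vB.
Qed.

End Formulation.

Theorem theorem1 (R : realFieldType) (N V : finType) (I : instance R N V) (r : N)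
    (Hsav : nonneg_savings I) (Htree : polytree I)
    (Hirr : irreducible_instance I) (Hr : r \in nodes I)
    (s : va_solution N V) (Hs : va_optimal I r s) :
  exists dep : V -> R, arises_from I r s dep /\ optimal_schedule I dep.
Proof.
case: Hs => s_ok s_opt; have [tau [tauP xE s_le]] := va_feasible_assignment Hsav s_ok.
exists (departure I r tau); split; first exact: departure_arises.
split; first exact: departure_feasible.
have [P P_ok P_saving] := departure_platooning Htree Hr tauP.
exists P => // dep' P' dep'_ok P'_ok; rewrite P_saving; apply: le_trans s_le.
have [tau' tau'P ->] := platooning_assignment Htree Hr dep'_ok P'_ok.
by have [s' s'_ok <-] := assignment_va_solution tau'P; apply: s_opt.
Qed.
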